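(* Let $E$ be an arbitrary (countable, not necessarily row-finite) directed graph, $K$ a field, $A$ a graded $K$-algebra, and $\pi:L_K(E)\to A$ a ring homomorphism with $\pi(v)\neq 0$ for every vertex $v\in E^0$, which maps each cycle without exits to a non-nilpotent homogeneous element of nonzero degree. Then $\pi$ is injective.
   Context: A graph $E=(E^0,E^1,r,s)$ consists of countable sets $E^0$ (vertices), $E^1$ (edges) and maps $r,s:E^1\to E^0$ (range, source). A vertex $v$ is regular if $s^{-1}(v)$ is finite and nonempty. A path (of positive length) is a sequence $\mu=e_1\cdots e_n$ of edges with $r(e_i)=s(e_{i+1})$. A cycle is a path $e_1\cdots e_n$ ($n\ge1$) with $s(e_1)=r(e_n)$ and $s(e_i)\neq s(e_j)$ for $i\ne j$. An edge $e$ is an exit for the path $e_1\cdots e_n$ if there is $i$ with $s(e)=s(e_i)$ and $e\ne e_i$. The Leavitt path algebra $L_K(E)$ is the $K$-algebra generated by a set $\{v: v\in E^0\}$ of pairwise orthogonal idempotents and elements $\{e,e^*: e\in E^1\}$ subject to: (1) $s(e)e=er(e)=e$; (2) $r(e)e^*=e^*s(e)=e^*$; (3) $e^*e'=\delta_{e,e'}r(e)$; (4) $v=\sum_{s(e)=v}ee^*$ for every regular vertex $v$. A path is identified with the corresponding product of edges in $L_K(E)$. ''Graded'' means $\mathbb{Z}$-graded. Rings need not be unital. *)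

(* Defs.v *)
From HB Require Import structures.
From mathcomp Require Import all_boot all_order all_algebra.
From mathcomp Require Import finmap all_classical.
Set Implicit Arguments.
Unset Strict Implicit.
Unset Printing Implicit Defensive.
Import GRing.Theory.
Local Open Scope ring_scope.

(** * Not necessarily unital associative algebras over a field *)

Reserved Notation "x ** y" (at level 40, left associativity).

HB.mixin Record Lmodule_isNUAlgebra (K : fieldType) A of GRing.Lmodule K A := {
  numul : A -> A -> A;
  numulA : associative numul;
  numulDl : left_distributive numul +%R;
  numulDr : right_distributive numul +%R;
  nuscaleAl : forall (k : K) (x y : A), k *: numul x y = numul (k *: x) y;
  nuscaleAr : forall (k : K) (x y : A), k *: numul x y = numul x (k *: y)
}.

#[short(type="nualgType")]
HB.structure Definition NUAlgebra (K : fieldType) :=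
  {A of GRing.Lmodule K A & Lmodule_isNUAlgebra K A}.

Notation "x ** y" := (numul x y) : ring_scope.

(* The power x^(n+1); there is no zeroth power without a unit. *)
Definition nupowS (K : fieldType) (A : nualgType K) (x : A) (n : nat) : A :=
  iter n (fun y => y ** x) x.

Definition nilpotent_elt (K : fieldType) (A : nualgType K) (x : A) : Prop :=
  exists n, nupowS x n = 0.

(* [gr n] is the homogeneous component of degree n: A is the internal direct
   sum of the K-subspaces [gr n], and [gr m ** gr n] lies in [gr (m + n)]. *)
Record Zgrading (K : fieldType) (A : nualgType K) (gr : int -> set A) : Prop := {
  Zgrading0 : forall n, gr n 0;
  ZgradingD : forall n x y, gr n x -> gr n y -> gr n (x + y);
  ZgradingZ : forall n (k : K) x, gr n x -> gr n (k *: x);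
  ZgradingM : forall m n x y, gr m x -> gr n y -> gr (m + n) (x ** y);
  Zgrading_span : forall x : A, exists (s : seq int) (a : int -> A),
    (forall n, gr n (a n)) /\ x = \sum_(n <- s) a n;
  Zgrading_direct : forall (s : seq int) (a : int -> A), uniq s ->
    (forall n, gr n (a n)) -> \sum_(n <- s) a n = 0 ->
    forall n, n \in s -> a n = 0
}.

(** * Algebras given by generators and relations *)

Inductive term (K : fieldType) (X : Type) : Type :=
| TGen of X
| TZero
| TOpp of term K X
| TAdd of term K X & term K X
| TScale of K & term K X
| TMul of term K X & term K X.
Arguments TGen {K X}.
Arguments TZero {K X}.

HB.instance Definition _ (K : fieldType) (X : Type) := gen_eqMixin (term K X).
HB.instance Definition _ (K : fieldType) (X : Type) :=
  gen_choiceMixin (term K X).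

Section Presented.
Variables (K : fieldType) (X : Type) (R : term K X -> term K X -> Prop).

(* The least congruence containing R and the axioms of a K-algebra. *)
Inductive pres_eq : term K X -> term K X -> Prop :=
| pe_rel t u : R t u -> pres_eq t u
| pe_refl t : pres_eq t t
| pe_sym t u : pres_eq t u -> pres_eq u t
| pe_trans t u v : pres_eq t u -> pres_eq u v -> pres_eq t v
| pe_opp t t' : pres_eq t t' -> pres_eq (TOpp t) (TOpp t')
| pe_add t t' u u' :
    pres_eq t t' -> pres_eq u u' -> pres_eq (TAdd t u) (TAdd t' u')
| pe_scale k t t' : pres_eq t t' -> pres_eq (TScale k t) (TScale k t')
| pe_mul t t' u u' :
    pres_eq t t' -> pres_eq u u' -> pres_eq (TMul t u) (TMul t' u')
| pe_addA t u v : pres_eq (TAdd t (TAdd u v)) (TAdd (TAdd t u) v)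
| pe_addC t u : pres_eq (TAdd t u) (TAdd u t)
| pe_add0 t : pres_eq (TAdd TZero t) t
| pe_addN t : pres_eq (TAdd (TOpp t) t) TZero
| pe_scaleA k l t : pres_eq (TScale k (TScale l t)) (TScale (k * l) t)
| pe_scale1 t : pres_eq (TScale 1 t) t
| pe_scaleDr k t u :
    pres_eq (TScale k (TAdd t u)) (TAdd (TScale k t) (TScale k u))
| pe_scaleDl k l t :
    pres_eq (TScale (k + l) t) (TAdd (TScale k t) (TScale l t))
| pe_mulA t u v : pres_eq (TMul t (TMul u v)) (TMul (TMul t u) v)
| pe_mulDl t u v : pres_eq (TMul (TAdd t u) v) (TAdd (TMul t v) (TMul u v))
| pe_mulDr t u v : pres_eq (TMul t (TAdd u v)) (TAdd (TMul t u) (TMul t v))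
| pe_scaleAl k t u : pres_eq (TScale k (TMul t u)) (TMul (TScale k t) u)
| pe_scaleAr k t u : pres_eq (TScale k (TMul t u)) (TMul t (TScale k u)).

Definition pres_eqb : rel (term K X) := fun t u => `[< pres_eq t u >].

Lemma pres_eqb_refl : reflexive pres_eqb.
Proof. by move=> t; apply/asboolP; apply: pe_refl. Qed.

Lemma pres_eqb_sym : symmetric pres_eqb.
Proof. by move=> t u; apply/asboolP/asboolP; apply: pe_sym. Qed.

Lemma pres_eqb_trans : transitive pres_eqb.
Proof.
by move=> u t v /asboolP tu /asboolP uv; apply/asboolP; apply: pe_trans tu uv.
Qed.

Canonical pres_equiv := EquivRel pres_eqb pres_eqb_refl pres_eqb_sym pres_eqb_trans.

Definition presented : Type := {eq_quot pres_equiv}%qT.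

HB.instance Definition _ := Choice.on presented.

Definition pres_class (t : term K X) : presented :=
  (\pi_({eq_quot pres_equiv}) t)%qT.

Definition pres_repr (x : presented) : term K X :=
  @repr _ {eq_quot pres_equiv}%qT x.

Lemma pres_reprK : cancel pres_repr pres_class.
Proof. by move=> x; rewrite /pres_class /pres_repr reprK. Qed.

Lemma pres_classP (t u : term K X) : pres_class t = pres_class u <-> pres_eq t u.
Proof.
split=> [/eqquotP /asboolP //|tu].
by apply/eqquotP; apply/asboolP.
Qed.

Lemma pres_repr_class (t : term K X) : pres_eq (pres_repr (pres_class t)) t.
Proof. by apply/pres_classP; rewrite pres_reprK. Qed.

Definition pres_zero := pres_class TZero.
Definition pres_opp x := pres_class (TOpp (pres_repr x)).
Definition pres_add x y := pres_class (TAdd (pres_repr x) (pres_repr y)).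
Definition pres_scale k x := pres_class (TScale k (pres_repr x)).
Definition pres_mul x y := pres_class (TMul (pres_repr x) (pres_repr y)).

Lemma pres_oppE t : pres_opp (pres_class t) = pres_class (TOpp t).
Proof. by apply/pres_classP; apply: pe_opp; apply: pres_repr_class. Qed.

Lemma pres_addE t u :
  pres_add (pres_class t) (pres_class u) = pres_class (TAdd t u).
Proof. by apply/pres_classP; apply: pe_add; apply: pres_repr_class. Qed.

Lemma pres_scaleE k t : pres_scale k (pres_class t) = pres_class (TScale k t).
Proof. by apply/pres_classP; apply: pe_scale; apply: pres_repr_class. Qed.

Lemma pres_mulE t u :
  pres_mul (pres_class t) (pres_class u) = pres_class (TMul t u).
Proof. by apply/pres_classP; apply: pe_mul; apply: pres_repr_class. Qed.

Let presE := (pres_oppE, pres_addE, pres_scaleE, pres_mulE).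

Lemma pres_ind (P : presented -> Prop) :
  (forall t, P (pres_class t)) -> forall x, P x.
Proof. by move=> Pt x; rewrite -[x]pres_reprK. Qed.

Fact pres_addA : associative pres_add.
Proof.
elim/pres_ind=> t; elim/pres_ind=> u; elim/pres_ind=> v.
by rewrite !presE; apply/pres_classP; apply: pe_addA.
Qed.

Fact pres_addC : commutative pres_add.
Proof.
elim/pres_ind=> t; elim/pres_ind=> u.
by rewrite !presE; apply/pres_classP; apply: pe_addC.
Qed.

Fact pres_add0 : left_id pres_zero pres_add.
Proof.
elim/pres_ind=> t.
by rewrite !presE; apply/pres_classP; apply: pe_add0.
Qed.

Fact pres_addN : left_inverse pres_zero pres_opp pres_add.
Proof.
elim/pres_ind=> t.
by rewrite !presE; apply/pres_classP; apply: pe_addN.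
Qed.

HB.instance Definition _ :=
  GRing.isZmodule.Build presented pres_addA pres_addC pres_add0 pres_addN.

Fact pres_scaleA k l x : pres_scale k (pres_scale l x) = pres_scale (k * l) x.
Proof.
elim/pres_ind: x => t.
by rewrite !presE; apply/pres_classP; apply: pe_scaleA.
Qed.

Fact pres_scale1 : left_id 1 pres_scale.
Proof.
elim/pres_ind=> t.
by rewrite !presE; apply/pres_classP; apply: pe_scale1.
Qed.

Fact pres_scaleDr : right_distributive pres_scale +%R.
Proof.
move=> k; elim/pres_ind=> t; elim/pres_ind=> u.
by rewrite /GRing.add /= !presE; apply/pres_classP; apply: pe_scaleDr.
Qed.

Fact pres_scaleDl x : {morph pres_scale^~ x : k l / k + l}.
Proof.
move=> k l; elim/pres_ind: x => t.
by rewrite [RHS]/GRing.add /= !presE; apply/pres_classP; apply: pe_scaleDl.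
Qed.

HB.instance Definition _ := GRing.Zmodule_isLmodule.Build K presented
  pres_scaleA pres_scale1 pres_scaleDr pres_scaleDl.

Fact pres_mulA : associative pres_mul.
Proof.
elim/pres_ind=> t; elim/pres_ind=> u; elim/pres_ind=> v.
by rewrite !presE; apply/pres_classP; apply: pe_mulA.
Qed.

Fact pres_mulDl : left_distributive pres_mul +%R.
Proof.
elim/pres_ind=> t; elim/pres_ind=> u; elim/pres_ind=> v.
by rewrite /GRing.add /= !presE; apply/pres_classP; apply: pe_mulDl.
Qed.

Fact pres_mulDr : right_distributive pres_mul +%R.
Proof.
elim/pres_ind=> t; elim/pres_ind=> u; elim/pres_ind=> v.
by rewrite /GRing.add /= !presE; apply/pres_classP; apply: pe_mulDr.
Qed.

Fact pres_scaleAl k (x y : presented) : k *: pres_mul x y = pres_mul (k *: x) y.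
Proof.
elim/pres_ind: x => t; elim/pres_ind: y => u.
by rewrite /GRing.scale /= !presE; apply/pres_classP; apply: pe_scaleAl.
Qed.

Fact pres_scaleAr k (x y : presented) : k *: pres_mul x y = pres_mul x (k *: y).
Proof.
elim/pres_ind: x => t; elim/pres_ind: y => u.
by rewrite /GRing.scale /= !presE; apply/pres_classP; apply: pe_scaleAr.
Qed.

HB.instance Definition _ := Lmodule_isNUAlgebra.Build K presented
  pres_mulA pres_mulDl pres_mulDr pres_scaleAl pres_scaleAr.

Definition pres_gen (x : X) : presented := pres_class (TGen x).

Lemma pres_class0 : pres_class TZero = 0. Proof. by []. Qed.
Lemma pres_classN t : pres_class (TOpp t) = - pres_class t.
Proof. by rewrite [RHS]/GRing.opp /= presE. Qed.
Lemma pres_classD t u : pres_class (TAdd t u) = pres_class t + pres_class u.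
Proof. by rewrite [RHS]/GRing.add /= presE. Qed.
Lemma pres_classZ k t : pres_class (TScale k t) = k *: pres_class t.
Proof. by rewrite [RHS]/GRing.scale /= presE. Qed.
Lemma pres_classM t u : pres_class (TMul t u) = pres_class t ** pres_class u.
Proof. by rewrite [RHS]/numul /= presE. Qed.

Definition pres_classE :=
  (pres_class0, pres_classN, pres_classD, pres_classZ, pres_classM).

Fixpoint teval (B : nualgType K) (f : X -> B) (t : term K X) : B :=
  match t with
  | TGen x => f x
  | TZero => 0
  | TOpp t => - teval f t
  | TAdd t u => teval f t + teval f u
  | TScale k t => k *: teval f t
  | TMul t u => teval f t ** teval f u
  end.

Lemma teval_pres_eq (B : nualgType K) (f : X -> B) :
  (forall t u, R t u -> teval f t = teval f u) ->
  forall t u, pres_eq t u -> teval f t = teval f u.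
Proof.
move=> fR t u; elim=> {t u} //=.
- by move=> t u v _ -> _ ->.
- by move=> t t' _ ->.
- by move=> t t' u u' _ -> _ ->.
- by move=> k t t' _ ->.
- by move=> t t' u u' _ -> _ ->.
- by move=> t u v; rewrite addrA.
- by move=> t u; rewrite addrC.
- by move=> t; rewrite add0r.
- by move=> t; rewrite addNr.
- by move=> k l t; rewrite scalerA.
- by move=> t; rewrite scale1r.
- by move=> k t u; rewrite scalerDr.
- by move=> k l t; rewrite scalerDl.
- by move=> t u v; rewrite numulA.
- by move=> t u v; rewrite numulDl.
- by move=> t u v; rewrite numulDr.
- by move=> k t u; rewrite nuscaleAl.
- by move=> k t u; rewrite nuscaleAr.
Qed.

Theorem presented_universal (B : nualgType K) (f : X -> B) :
  (forall t u, R t u -> teval f t = teval f u) ->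
  exists! g : presented -> B,
    [/\ forall x y, g (x + y) = g x + g y,
        forall k x, g (k *: x) = k *: g x,
        forall x y, g (x ** y) = g x ** g y &
        forall x, g (pres_gen x) = f x].
Proof.
move=> fR; pose g x := teval f (pres_repr x).
have gE t : g (pres_class t) = teval f t.
  by apply: teval_pres_eq fR _ _ _; apply: pres_repr_class.
exists g; split.
  split.
  - by elim/pres_ind=> t; elim/pres_ind=> u; rewrite -pres_classD !gE.
  - by move=> k; elim/pres_ind=> t; rewrite -pres_classZ !gE.
  - by elim/pres_ind=> t; elim/pres_ind=> u; rewrite -pres_classM !gE.
  - by move=> x; rewrite gE.
move=> h [hD hZ hM hX]; apply/funext; elim/pres_ind=> t; rewrite gE.
have h0 : h 0 = 0 by rewrite -[0 in LHS](scale0r 0) hZ scale0r.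
have hN x : h (- x) = - h x by rewrite -scaleN1r hZ scaleN1r.
elim: t => [x||t IHt|t IHt u IHu|k t IHt|t IHt u IHu] /=.
- by rewrite hX.
- by rewrite h0.
- by rewrite pres_classN hN IHt.
- by rewrite pres_classD hD IHt IHu.
- by rewrite pres_classZ hZ IHt.
- by rewrite pres_classM hM IHt IHu.
Qed.

End Presented.

(** * Graphs *)

Record digraph := Digraph {
  vertex : countType;
  edge : countType;
  erange : edge -> vertex;
  esource : edge -> vertex
}.
Arguments erange {E} e : rename.
Arguments esource {E} e : rename.

Section Graph.
Variable E : digraph.

Definition emitted (v : vertex E) : set (edge E) := [set e | esource e = v]%classic.

Definition regular (v : vertex E) : Prop :=
  finite_set (emitted v) /\ (emitted v !=set0)%classic.

Definition composable : rel (edge E) := fun e f => erange e == esource f.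

(* [cycle composable c] requires in addition to the composability of
   consecutive edges that the range of the last edge of c is the source of the
   first one. *)
Definition graph_cycle (c : seq (edge E)) : bool :=
  [&& c != [::], cycle composable c & uniq (map esource c)].

Definition is_exit (f : edge E) (c : seq (edge E)) : Prop :=
  exists2 e, e \in c & esource f = esource e /\ f <> e.

Definition no_exit (c : seq (edge E)) : Prop := forall f, ~ is_exit f c.

End Graph.

(** * Leavitt path algebras *)

Inductive leavitt_gen (E : digraph) : Type :=
| GVertex of vertex E
| GEdge of edge E
| GGhost of edge E.

Section Leavitt.
Variables (K : fieldType) (E : digraph).

Local Notation tm := (term K (leavitt_gen E)).
Local Notation V v := (TGen (GVertex v) : tm).
Local Notation D e := (TGen (GEdge e) : tm).
Local Notation G e := (TGen (GGhost e) : tm).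

Inductive leavitt_rel : tm -> tm -> Prop :=
| lr_idem v : leavitt_rel (TMul (V v) (V v)) (V v)
| lr_orth v w : v <> w -> leavitt_rel (TMul (V v) (V w)) TZero
| lr_source_edge e : leavitt_rel (TMul (V (esource e)) (D e)) (D e)
| lr_edge_range e : leavitt_rel (TMul (D e) (V (erange e))) (D e)
| lr_range_ghost e : leavitt_rel (TMul (V (erange e)) (G e)) (G e)
| lr_ghost_source e : leavitt_rel (TMul (G e) (V (esource e))) (G e)
| lr_ghost_edge e : leavitt_rel (TMul (G e) (D e)) (V (erange e))
| lr_ghost_edge0 e f : e <> f -> leavitt_rel (TMul (G e) (D f)) TZero
| lr_regular v : regular v ->
    leavitt_rel (V v)
      (\big[@TAdd K (leavitt_gen E)/TZero]_(e <- fset_set (emitted v))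
         TMul (D e) (G e)).

Definition leavitt : nualgType K := presented leavitt_rel.

Definition lvertex (v : vertex E) : leavitt := pres_gen leavitt_rel (GVertex v).
Definition ledge (e : edge E) : leavitt := pres_gen leavitt_rel (GEdge e).
Definition lghost (e : edge E) : leavitt := pres_gen leavitt_rel (GGhost e).

(* The product e1 ** ... ** en of the edges of a path; the value 0 on the empty
   sequence, which is not a path of positive length, is a dummy. *)
Definition lpath (c : seq (edge E)) : leavitt :=
  if c is e :: p then foldl (fun x f => x ** ledge f) (ledge e) p else 0.

Lemma leavitt_relP t u :
  leavitt_rel t u -> pres_class leavitt_rel t = pres_class leavitt_rel u.
Proof. by move=> tu; apply/pres_classP; apply: pe_rel. Qed.

Lemma lvertexM v w : lvertex v ** lvertex w = if v == w then lvertex v else 0.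
Proof.
rewrite -pres_classM; case: eqP => [->|vw]; apply: leavitt_relP.
  exact: lr_idem.
exact: lr_orth.
Qed.

Lemma lsource_edge e : lvertex (esource e) ** ledge e = ledge e.
Proof. by rewrite -pres_classM; apply/leavitt_relP/lr_source_edge. Qed.

Lemma ledge_range e : ledge e ** lvertex (erange e) = ledge e.
Proof. by rewrite -pres_classM; apply/leavitt_relP/lr_edge_range. Qed.

Lemma lrange_ghost e : lvertex (erange e) ** lghost e = lghost e.
Proof. by rewrite -pres_classM; apply/leavitt_relP/lr_range_ghost. Qed.

Lemma lghost_source e : lghost e ** lvertex (esource e) = lghost e.
Proof. by rewrite -pres_classM; apply/leavitt_relP/lr_ghost_source. Qed.

Lemma lghost_edge e f :
  lghost e ** ledge f = if e == f then lvertex (erange e) else 0.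
Proof.
rewrite -pres_classM; case: eqP => [->|ef]; apply: leavitt_relP.
  exact: lr_ghost_edge.
exact: lr_ghost_edge0.
Qed.

Lemma lvertex_regular v : regular v ->
  lvertex v = \sum_(e \in emitted v) ledge e ** lghost e.
Proof.
move=> rv; rewrite fsbig_finite; last by case: rv.
transitivity (pres_class leavitt_rel
  (\big[@TAdd K (leavitt_gen E)/TZero]_(e <- fset_set (emitted v))
     TMul (D e) (G e))); first exact/leavitt_relP/lr_regular.
elim/big_rec2: _ => [//|e x t _ <-].
by rewrite pres_classD pres_classM.
Qed.

End Leavitt.
Arguments lvertex {K E} v.
Arguments ledge {K E} e.
Arguments lghost {K E} e.
Arguments lpath {K E} c.

(* Main.v *)
(** Let I be the kernel of pi. An element of L_K(E) in I is shown to vanish by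
    induction on the length of its ghost paths: if alpha = y + sum a_e e^* lies
    in I, with y a combination of real paths and e ranging over a finite set S
    of edges, then each alpha e with e in S has shorter ghost paths, so
    alpha e = 0. If S contains every edge leaving a regular vertex v, then
    alpha v = sum alpha e e^* = 0; otherwise v is a sink or some f outside S
    leaves v, and alpha v = 0 follows from the independence modulo I of
    distinct real paths.
    For the latter, multiplying a combination in I by mu^*, with mu a shortest
    path occurring in it, gives k v + sum k_i gamma_i in I with gamma_i closed
    walks at v. Conjugating by a path that leaves some gamma_i through an exit
    removes gamma_i, so one is left with closed walks without exits. They are
    powers of one cycle c, so P(c) lies in I for a nonzero polynomial P.
    This is impossible: write P = (X - 1) Q + k and a = pi(c). If k = 0, then
    b = pi(Q(c)) satisfies a b = b, which forces b = 0 because a is homogeneous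
    of nonzero degree. Otherwise a = d - a d for some d, whose components
    would include all the powers of a. As pi is only a ring homomorphism,
    pi(k v) need not be homogeneous, and the argument does not use that it is. *)

Require Import Defs.
From HB Require Import structures.
From mathcomp Require Import all_boot all_order all_algebra.
From mathcomp Require Import finmap all_classical.
From mathcomp Require Import zify.
Import GRing.Theory.
Local Open Scope ring_scope.
Set Implicit Arguments.
Unset Strict Implicit.
Unset Printing Implicit Defensive.

(** * Finite sums and algebras without unit *)

Lemma sum_widen_support (T : eqType) (V : nmodType) (s t : seq T)
    (f : T -> V) : uniq s -> uniq t -> {subset s <= t} ->
  (forall i, i \notin s -> f i = 0) -> \sum_(i <- t) f i = \sum_(i <- s) f i.
Proof.
move=> us ut st f0; rewrite (bigID (mem s)) /= [X in _ + X]big1 ?addr0.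
  rewrite -big_filter; apply: perm_big; apply: uniq_perm => //.
    exact: filter_uniq.
  by move=> i; rewrite mem_filter /=; case: (boolP (i \in s)) => // /st ->.
by move=> i; apply: f0.
Qed.

Section NonUnitalAlgebra.
Variables (K : fieldType) (A : nualgType K).
Implicit Types x y z : A.

Lemma numul0l x : 0 ** x = 0.
Proof. by apply: (addIr (0 ** x)); rewrite -numulDl !add0r. Qed.

Lemma numul0r x : x ** 0 = 0.
Proof. by apply: (addIr (x ** 0)); rewrite -numulDr !add0r. Qed.

Lemma numulNl x y : (- x) ** y = - (x ** y).
Proof. by apply/eqP; rewrite -addr_eq0 -numulDl addNr numul0l. Qed.

Lemma numulBl x y z : (x - y) ** z = x ** z - y ** z.
Proof. by rewrite numulDl numulNl. Qed.

Lemma numul_suml (I : Type) (r : seq I) (P : pred I) (F : I -> A) x :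
  (\sum_(i <- r | P i) F i) ** x = \sum_(i <- r | P i) F i ** x.
Proof.
by apply: (big_morph (fun y => y ** x)) => [y z|]; rewrite ?numulDl ?numul0l.
Qed.

Lemma numul_sumr (I : Type) (r : seq I) (P : pred I) (F : I -> A) x :
  x ** (\sum_(i <- r | P i) F i) = \sum_(i <- r | P i) x ** F i.
Proof.
by apply: (big_morph (fun y => x ** y)) => [y z|]; rewrite ?numulDr ?numul0r.
Qed.

Lemma nupowSl x n : x ** nupowS x n = nupowS x n.+1.
Proof. by elim: n => //= n IHn; rewrite numulA IHn. Qed.

End NonUnitalAlgebra.

(** * Homogeneous components in a graded algebra *)

Section GradedAlgebra.
Variables (K : fieldType) (A : nualgType K) (gr : int -> set A).
Hypothesis grA : Zgrading gr.

(** The components form a total function of the degree, with the finite support hidden in an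
    existential, so that decompositions can be shifted and compared degree by degree. *)
Definition hdecomp (x : A) (f : int -> A) : Prop :=
  (forall n, gr n (f n)) /\
  exists s : seq int, [/\ uniq s, forall n, n \notin s -> f n = 0 &
                          x = \sum_(n <- s) f n].

Lemma hdecomp_exists x : exists f, hdecomp x f.
Proof.
have [s [a [gra ->]]] := Zgrading_span grA x.
(* [Zgrading_span] allows repeated degrees in [s]; the multiplicities absorb them. *)
exists (fun n => a n *+ count_mem n s); split.
  move=> n; elim: (count_mem n s) => [|m IHm].
    by rewrite mulr0n; apply: Zgrading0 grA _.
  by rewrite mulrS; apply: (ZgradingD grA).
exists (undup s); split; first exact: undup_uniq.
  by move=> n; rewrite mem_undup => /count_memPn ->.
by rewrite -big_undup_iterop_count; apply: eq_bigr.
Qed.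

Lemma hdecomp_unique x f g : hdecomp x f -> hdecomp x g -> f =1 g.
Proof.
move=> [grf [s [us fs xs]]] [grg [t [ut gt xt]]] n.
have grN m y : gr m y -> gr m (- y).
  by rewrite -scaleN1r; apply: (ZgradingZ grA).
have sub0 : \sum_(m <- undup (s ++ t)) (f m - g m) = 0.
  rewrite sumrB (@sum_widen_support _ _ s (undup _)) ?undup_uniq //; last first.
    by move=> i; rewrite mem_undup mem_cat => ->.
  rewrite (@sum_widen_support _ _ t (undup _)) ?undup_uniq -?xs -?xt ?subrr //.
  by move=> i; rewrite mem_undup mem_cat orbC => ->.
apply/eqP; rewrite -subr_eq0; apply/eqP.
have [nst|] := boolP (n \in undup (s ++ t)).
  apply: (Zgrading_direct grA (undup_uniq _) _ sub0 nst) => m.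
  by apply: (ZgradingD grA) => //; apply: grN.
rewrite mem_undup mem_cat negb_or => /andP[/fs -> /gt ->].
by rewrite subrr.
Qed.

Lemma hdecomp_homogeneous n a :
  gr n a -> hdecomp a (fun m => if m == n then a else 0).
Proof.
move=> gra; split=> [m|].
  by case: eqP => [->|_] //; apply: (Zgrading0 grA).
exists [:: n]; split=> //; last by rewrite big_seq1 eqxx.
by move=> m; rewrite inE => /negPf ->.
Qed.

Lemma hdecompB x y f g :
  hdecomp x f -> hdecomp y g -> hdecomp (x - y) (fun n => f n - g n).
Proof.
move=> [grf [s [us fs xs]]] [grg [t [ut gt xt]]]; split=> [n|].
  apply: (ZgradingD grA) => //.
  by rewrite -scaleN1r; apply: (ZgradingZ grA).
exists (undup (s ++ t)); split; first exact: undup_uniq.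
  move=> n; rewrite mem_undup mem_cat negb_or => /andP[/fs -> /gt ->].
  by rewrite subrr.
rewrite sumrB (@sum_widen_support _ _ s (undup _)) ?undup_uniq //; last first.
  by move=> i; rewrite mem_undup mem_cat => ->.
rewrite (@sum_widen_support _ _ t (undup _)) ?undup_uniq -?xs -?xt //.
by move=> i; rewrite mem_undup mem_cat orbC => ->.
Qed.

Lemma hdecompMl n a x f :
  gr n a -> hdecomp x f -> hdecomp (a ** x) (fun m => a ** f (m - n)).
Proof.
move=> gra [grf [s [us fs xs]]]; split=> [m|].
  by rewrite -[m in gr m](subrKC n); apply: (ZgradingM grA).
exists [seq m + n | m <- s]; split.
- by rewrite map_inj_uniq //; apply: addIr.
- move=> m Hm; rewrite fs ?numul0r //; apply: contra Hm => Hm.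
  by apply/mapP; exists (m - n) => //; rewrite subrK.
- by rewrite xs numul_sumr big_map; apply: eq_bigr => m _; rewrite addrK.
Qed.

(** The degrees [m + n *+ j] are pairwise distinct, and a finite support cannot contain them all. *)
Lemma hdecomp_finite x f m n : hdecomp x f -> n <> 0 ->
  ~ (forall j, f (m + n *+ j) <> 0).
Proof.
move=> [_ [s [us fs _]]] n0 fn0.
suff: (size [seq (m + n *+ j)%R | j <- iota 0 (size s).+1] <= size s)%N.
  by rewrite size_map size_iota ltnn.
apply: uniq_leq_size.
  rewrite map_inj_uniq ?iota_uniq // => i j /addrI /eqP.
  rewrite -[n *+ i]mulr_natr -[n *+ j]mulr_natr (inj_eq (mulfI _)).
    by rewrite Num.Theory.eqr_nat => /eqP.
  exact/eqP.
by move=> _ /mapP[j _ ->]; apply: contraT => /fs /fn0.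
Qed.

(** Comparing components gives [f m = a ** f (m - n)], so a nonzero component in degree [m] forces
    nonzero ones in all degrees [m - j * n]. *)
Lemma homogeneous_fix_eq0 n a b : n <> 0 -> gr n a -> a ** b = b -> b = 0.
Proof.
move=> n0 gra ab; have [f bf] := hdecomp_exists b.
have fE m : f m = a ** f (m - n).
  apply: (@hdecomp_unique b f (fun m => a ** f (m - n))) => //.
  by rewrite -[b]ab; apply: hdecompMl.
have [_ [s [_ _ ->]]] := bf; apply: big1 => m _; apply: contrapT => fm.
apply: (@hdecomp_finite b f m (- n) bf).
  by move/eqP; rewrite oppr_eq0 => /eqP.
elim=> [|j IHj]; first by rewrite mulr0n addr0.
by move=> fj; apply: IHj; rewrite fE -addrA -mulrSr fj numul0r.
Qed.

(* The components of [d] in degrees divisible by [n] satisfy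
   [d_k = a ** d_(k - n)] for [k <> n], so they vanish for [k <= 0] and then
   [d_(j * n)] is the [j]-th power of [a]. *)
Lemma homogeneous_sub_neq n a d : n <> 0 -> gr n a -> ~ nilpotent_elt a ->
  d - a ** d <> a.
Proof.
move=> n0 gra nila da; have [f df] := hdecomp_exists d.
have fE m : f m - a ** f (m - n) = if m == n then a else 0.
  apply: (@hdecomp_unique a (fun m => f m - a ** f (m - n))
                            (fun m => if m == n then a else 0)).
    by rewrite -{1}da; apply: hdecompB df (hdecompMl gra df).
  exact: hdecomp_homogeneous.
have fS m : m != n -> f m = a ** f (m - n).
  by move=> /negPf mn; apply/eqP; rewrite -subr_eq0 fE mn.
have f0 : f 0 = 0.
  apply: contrapT => f0; apply: (@hdecomp_finite d f 0 (- n) df).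
    by move/eqP; rewrite oppr_eq0 => /eqP.
  elim=> [|j IHj]; first by rewrite mulr0n addr0.
  move=> fj; apply: IHj; rewrite fS ?add0r ?mulNrn.
    by move: fj; rewrite add0r mulNrn mulrSr opprD => ->; rewrite numul0r.
  rewrite -subr_eq0 -opprD oppr_eq0 -mulrSr Num.Theory.mulrn_eq0 /=.
  exact/eqP.
apply: (@hdecomp_finite d f n n df n0) => j fj; apply: nila; exists j.
rewrite -fj {fj}; elim: j => [|j IHj].
  by have:= fE n; rewrite eqxx subrr f0 numul0r subr0 mulr0n addr0.
rewrite fS; last first.
  by rewrite -subr_eq0 addrC addKr Num.Theory.mulrn_eq0 /=; apply/eqP.
by rewrite mulrSr addrA addrK -IHj nupowSl.
Qed.

End GradedAlgebra.

(** * Walks, closed walks and exits *)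

Section Walks.
Variable E : digraph.
Implicit Types (u v : vertex E) (e f : edge E) (p q c : seq (edge E)).

Fixpoint is_walk u p : bool :=
  if p is e :: p' then (esource e == u) && is_walk (erange e) p' else true.

Definition walk_end u p : vertex E := last u (map erange p).

Lemma is_walk_cat u p q :
  is_walk u (p ++ q) = is_walk u p && is_walk (walk_end u p) q.
Proof. by elim: p u => //= e p IHp u; rewrite IHp andbA. Qed.

Lemma walk_end_cat u p q : walk_end u (p ++ q) = walk_end (walk_end u p) q.
Proof. by rewrite /walk_end map_cat last_cat. Qed.

Lemma walk_end_rcons u p e : walk_end u (rcons p e) = erange e.
Proof. by rewrite /walk_end map_rcons last_rcons. Qed.

Lemma is_walk_rcons u p e :
  is_walk u (rcons p e) = is_walk u p && (esource e == walk_end u p).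
Proof. by rewrite -cats1 is_walk_cat /= andbT. Qed.

Definition closed_walk v p : bool :=
  [&& p != [::], is_walk v p & walk_end v p == v].

Lemma walk_end_take v c (e0 : edge E) i : is_walk v c -> (i < size c)%N ->
  walk_end v (take i c) = esource (nth e0 c i).
Proof.
move=> + ic; rewrite -{1}[c](cat_take_drop i) (drop_nth e0 ic) is_walk_cat /=.
by case/and3P=> _ /eqP ->.
Qed.

Lemma is_walk_path v p :
  is_walk v p = (if p is e :: p' then
                   (esource e == v) && path (@composable E) e p' else true).
Proof.
elim: p v => //= e p IHp v; rewrite IHp; case: p {IHp} => //= f p.
by rewrite /composable [erange e == _]eq_sym.
Qed.

Lemma sub_no_exit c p : {subset p <= c} -> no_exit c -> no_exit p.
Proof. by move=> pc nc f [e /pc ec ef]; apply: (nc f); exists e. Qed.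

(** Each edge of [c] is the only edge leaving its source, so a walk starting where [c] does must
    follow [c] as long as [c] lasts. *)
Lemma no_exit_prefix v c p : no_exit c -> is_walk v c -> is_walk v p ->
  (size c <= size p)%N -> prefix c p.
Proof.
elim: c v p => [|e c IHc] v [|f p] //= nc /andP[/eqP sv wc] /andP[/eqP fv wp].
rewrite ltnS => cp; have fe : f = e.
  apply: contrapT => fe; apply: (nc f); exists e; first exact: mem_head.
  by rewrite fv sv.
rewrite fe in wp *; rewrite eqxx /=; apply: IHc wc wp cp.
by move=> x [y yc xy]; apply: (nc x); exists y => //; rewrite inE yc orbT.
Qed.

(** Minimal length makes [c] both a simple cycle and a generator of all exit-free closed walks at
    [v]. *)
Lemma shortest_no_exit v p : closed_walk v p -> no_exit p ->
  exists c, [/\ closed_walk v c, no_exit c &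
    forall q, closed_walk v q -> no_exit q -> (size c <= size q)%N].
Proof.
move=> cp np.
pose P n := `[< exists c, [/\ closed_walk v c, no_exit c & size c = n] >].
have exP : exists n, P n by exists (size p); apply/asboolP; exists p.
case: (ex_minnP exP) => n /asboolP[c [cc nc <-]] minc; exists c; split=> // q cq nq.
by apply: minc; apply/asboolP; exists q.
Qed.

Section Shortest.
Variables (v : vertex E) (c : seq (edge E)).
Hypotheses (cc : closed_walk v c) (nc : no_exit c).
Hypothesis minc :
  forall q, closed_walk v q -> no_exit q -> (size c <= size q)%N.

(** If two edges of [c] had the same source, cutting out the segment between them would give a
    shorter exit-free closed walk. *)
Lemma shortest_graph_cycle : graph_cycle c.
Proof.
have /and3P[c0 wc /eqP ec] := cc; apply/and3P; split=> //.
  case: (c) c0 wc ec => // e p _ wc ec.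
  (* [cycle] unfolds to a path along [rcons p e], so the first edge is appended once more. *)
  have /= se := wc; have: is_walk v (e :: rcons p e).
    by rewrite -rcons_cons is_walk_rcons wc ec; case/andP: se.
  by rewrite is_walk_path => /andP[].
have e0 : edge E by case: (c) c0.
apply: contraT => /(uniqPn v)[i [j [ij]]]; rewrite size_map => jc.
have ic := ltn_trans ij jc.
rewrite !(nth_map e0) // => sij.
have: closed_walk v (take i c ++ drop j c).
  move: (wc) ec; rewrite -{1 2}[c](cat_take_drop j) is_walk_cat walk_end_cat.
  rewrite (walk_end_take e0) // -sij -(walk_end_take e0 wc ic).
  move=> /andP[_ wd] ed.
  rewrite /closed_walk is_walk_cat walk_end_cat ed eqxx wd !andbT.
  (* As [i] may be 0, nonemptiness comes from [drop j c], where [j < size c]. *)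
  rewrite -size_eq0 size_cat size_drop addn_eq0 subn_eq0 leqNgt jc andbF /=.
  by move: wc; rewrite -{1}[c](cat_take_drop i) is_walk_cat => /andP[].
move=> cij; have: (size c <= size (take i c ++ drop j c))%N.
  apply: minc cij _; apply: sub_no_exit nc => x.
  by rewrite mem_cat => /orP[/mem_take|/mem_drop].
by rewrite size_cat size_takel ?size_drop ?(ltnW ic) //; lia.
Qed.

(** By minimality [c] is no longer than [p], hence a prefix of it; what remains is empty or again an
    exit-free closed walk at [v]. *)
Lemma no_exit_closed_walkE p : closed_walk v p -> no_exit p ->
  p = flatten (nseq (size p %/ size c) c).
Proof.
have [n] := ubnP (size p); elim: n p => // n IHn p; rewrite ltnS => pn cp np.
have /and3P[c0 wc /eqP ec] := cc; have /and3P[p0 wp /eqP ep] := cp.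
have cpos : (0 < size c)%N by rewrite lt0n size_eq0.
have /prefixP[q pq] := no_exit_prefix nc wc wp (minc cp np).
rewrite pq size_cat divnDl // divnn cpos add1n /=.
have [->|q0] := eqVneq q [::]; first by rewrite div0n.
congr (c ++ _); apply: IHn.
- apply: leq_trans pn; rewrite pq size_cat -[X in (X < _)%N]add0n ltn_add2r //.
- move: wp ep; rewrite pq is_walk_cat walk_end_cat ec /closed_walk q0.
  by move=> /andP[_ ->] ->; rewrite eqxx.
- by apply: sub_no_exit np => x xq; rewrite pq mem_cat xq orbT.
Qed.

End Shortest.
End Walks.

(** * Real and ghost paths as elements of the Leavitt path algebra *)

Section WalkElements.
Variables (K : fieldType) (E : digraph).
Local Notation L := (leavitt K E).
Implicit Types (u v : vertex E) (e f : edge E) (p q c : seq (edge E)).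

(* [walk u p] and [cowalk u p] are the elements mu and mu^* of L_K(E) for the
   path mu with source [u] and edges [p]; here [p] may be empty. *)
Definition walk u p : L := foldl (fun x e => x ** ledge e) (lvertex u) p.

Definition cowalk u p : L := foldl (fun x e => lghost e ** x) (lvertex u) p.

Lemma walk_rcons u p e : walk u (rcons p e) = walk u p ** ledge e.
Proof. by rewrite /walk -cats1 foldl_cat. Qed.

Lemma cowalk_rcons u p e : cowalk u (rcons p e) = lghost e ** cowalk u p.
Proof. by rewrite /cowalk -cats1 foldl_cat. Qed.

Lemma walkM_end u p : walk u p ** lvertex (walk_end u p) = walk u p.
Proof.
case/lastP: p => [|p e]; first by rewrite /walk lvertexM eqxx.
by rewrite walk_end_rcons walk_rcons -numulA ledge_range.
Qed.

Lemma source_walk u p : lvertex u ** walk u p = walk u p.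
Proof.
elim/last_ind: p => [|p e IHp]; first by rewrite /walk lvertexM eqxx.
by rewrite walk_rcons numulA IHp.
Qed.

Lemma walkM u p q : walk u p ** walk (walk_end u p) q = walk u (p ++ q).
Proof.
elim/last_ind: q => [|q e IHq]; first by rewrite cats0 walkM_end.
by rewrite -rcons_cat !walk_rcons numulA IHq.
Qed.

Lemma walkM0 u v p q : walk_end u p != v -> walk u p ** walk v q = 0.
Proof.
move=> uv; rewrite -walkM_end -[walk v q]source_walk -numulA.
by rewrite [lvertex _ ** (_ ** _)]numulA lvertexM (negPf uv) numul0l numul0r.
Qed.

Lemma walkM_vertex u v p :
  walk u p ** lvertex v = if walk_end u p == v then walk u p else 0.
Proof.
case: eqP => [<-|/eqP uv]; first exact: walkM_end.
exact: (@walkM0 _ _ p [::]).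
Qed.

Lemma walkM_edge u p e :
  walk u p ** ledge e =
  if walk_end u p == esource e then walk u (rcons p e) else 0.
Proof.
rewrite -lsource_edge numulA walkM_vertex.
by case: eqP => [_|_]; rewrite ?walk_rcons ?numul0l.
Qed.

Lemma walk_cons u p e :
  esource e = u -> walk u (e :: p) = ledge e ** walk (erange e) p.
Proof.
move=> eu; rewrite -cat1s -walkM; congr (_ ** _).
by rewrite /walk /= -eu lsource_edge.
Qed.

Lemma lpathE u e p : esource e = u -> lpath (e :: p) = walk u (e :: p).
Proof. by move=> <-; rewrite /walk /= lsource_edge. Qed.

Lemma cowalkK u p q :
  is_walk u p -> cowalk u p ** walk u (p ++ q) = walk (walk_end u p) q.
Proof.
elim/last_ind: p q => [|p e IHp] q; first by rewrite source_walk.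
rewrite is_walk_rcons => /andP[wp /eqP se].
rewrite cowalk_rcons -numulA cat_rcons IHp // walk_cons // numulA lghost_edge.
by rewrite eqxx source_walk walk_end_rcons.
Qed.

Lemma cowalk_walk u p :
  is_walk u p -> cowalk u p ** walk u p = lvertex (walk_end u p).
Proof. by move=> wp; have := cowalkK [::] wp; rewrite cats0. Qed.

Lemma cowalk_source u p : cowalk u p ** lvertex u = cowalk u p.
Proof.
elim/last_ind: p => [|p e IHp]; first by rewrite /cowalk lvertexM eqxx.
by rewrite cowalk_rcons -numulA IHp.
Qed.

(** Where the walks first differ, some [e^* f] with [e <> f] appears. The length bound excludes a
    [q] that is a proper prefix of [p], for which the product is a ghost path. *)
Lemma cowalk_walk0 u p q : is_walk u p -> is_walk u q ->
  (size p <= size q)%N -> ~~ prefix p q -> cowalk u p ** walk u q = 0.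
Proof.
elim/last_ind: p => [|p e IHp]; first by rewrite prefix0s.
rewrite is_walk_rcons size_rcons cowalk_rcons => /andP[wp _] wq pq npq.
have [/prefixP[q' qE]|/(IHp wp wq (ltnW pq)) H] := boolP (prefix p q); last first.
  by rewrite -numulA H numul0r.
case: q' => [|f q'] in qE; first by rewrite qE cats0 ltnn in pq.
have sf : esource f = walk_end u p.
  by move: wq; rewrite qE is_walk_cat => /andP[_ /andP[/eqP]].
rewrite qE -numulA cowalkK // walk_cons // numulA lghost_edge.
case: eqP => [ef|_]; last by rewrite numul0l.
by move: npq; rewrite qE ef -cat_rcons prefix_prefix.
Qed.

(** This is P(c), with [lvertex v] in the role of the unit: [walk v [::]] is the zeroth power. *)
Definition cycle_horner v c (P : {poly K}) : L :=
  \sum_(i < size P) P`_i *: walk v (flatten (nseq i c)).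

Section CycleHorner.
Variables (v : vertex E) (c : seq (edge E)).
Hypothesis vc : walk_end v c = v.
Local Notation ev := (cycle_horner v c).

Lemma cycle_horner_widen n (P : {poly K}) : (size P <= n)%N ->
  ev P = \sum_(i < n) P`_i *: walk v (flatten (nseq i c)).
Proof.
move=> Pn; rewrite /cycle_horner.
rewrite (big_ord_widen n (fun i => P`_i *: walk v (flatten (nseq i c)))) //.
rewrite big_mkcond; apply: eq_bigr => i _; case: ltnP => // Pi.
by rewrite nth_default // scale0r.
Qed.

Lemma cycle_hornerD P Q : ev (P + Q) = ev P + ev Q.
Proof.
rewrite !(@cycle_horner_widen (maxn (size P) (size Q))) ?leq_maxl ?leq_maxr //.
  by rewrite -big_split; apply: eq_bigr => i _; rewrite coefD scalerDl.
exact: size_polyD.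
Qed.

Lemma cycle_hornerZ k P : ev (k *: P) = k *: ev P.
Proof.
rewrite (@cycle_horner_widen (size P)) ?size_scale_leq //.
by rewrite scaler_sumr; apply: eq_bigr => i _; rewrite coefZ scalerA.
Qed.

Lemma cycle_horner0 : ev 0 = 0.
Proof. by rewrite -(scale0r 0) cycle_hornerZ scale0r. Qed.

Lemma cycle_hornerC k : ev k%:P = k *: lvertex v.
Proof.
by rewrite (@cycle_horner_widen 1) ?size_polyC_leq1 // big_ord1 coefC.
Qed.

Lemma cycle_hornerXn n : ev 'X^n = walk v (flatten (nseq n c)).
Proof.
rewrite /cycle_horner size_polyXn big_ord_recr /= coefXn eqxx scale1r.
by rewrite big1 ?add0r // => i _; rewrite coefXn ltn_eqF ?scale0r.
Qed.

Lemma cycle_hornerMX P : ev ('X * P) = walk v c ** ev P.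
Proof.
rewrite (@cycle_horner_widen (size P).+1); last first.
  have [->|P0] := eqVneq P 0; first by rewrite mulr0 size_poly0.
  by rewrite mulrC size_mulX.
rewrite big_ord_recl mulrC coefMX scale0r add0r numul_sumr.
apply: eq_bigr => i _; rewrite coefMX /= -nuscaleAr.
by rewrite -(walkM v c) vc.
Qed.

End CycleHorner.
End WalkElements.
Arguments walk {K E} u p.
Arguments cowalk {K E} u p.
Arguments cycle_horner {K E} v c P.

(** * Combinations of real paths and length of ghost paths *)

Section GhostDegree.
Variables (K : fieldType) (E : digraph).
Local Notation L := (leavitt K E).
Implicit Types (x y z : L) (n : nat).

Lemma leavitt_ind (P : L -> Prop) :
    (forall v, P (lvertex v)) -> (forall e, P (ledge e)) ->
    (forall e, P (lghost e)) -> P 0 -> (forall x y, P x -> P y -> P (x + y)) ->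
    (forall k x, P x -> P (k *: x)) ->
    (forall x y, P x -> P y -> P (x ** y)) ->
  forall x, P x.
Proof.
move=> Pv Pe Pg P0 PD PZ PM; elim/pres_ind.
elim=> [[v|e|e]||t Pt|t Pt u Pu|k t Pt|t Pt u Pu]; rewrite ?pres_classE.
- exact: Pv.
- exact: Pe.
- exact: Pg.
- exact: P0.
- by rewrite -scaleN1r; apply: PZ.
- exact: PD.
- exact: PZ.
- exact: PM.
Qed.

(** The common core of [real_eltD] and [ghost_leD]: coefficients are extended by 0 and added over
    the merged index list. *)
Lemma sum_undup_cat (T : eqType) (V W : nmodType) (F : T -> V -> W)
    (s t : seq T) (a b : T -> V) :
    (forall i, F i 0 = 0) -> (forall i c d, F i (c + d) = F i c + F i d) ->
    uniq s -> uniq t ->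
  \sum_(i <- undup (s ++ t))
     F i ((if i \in s then a i else 0) + (if i \in t then b i else 0)) =
  \sum_(i <- s) F i (a i) + \sum_(i <- t) F i (b i).
Proof.
move=> F0 FD us ut.
under eq_bigr do rewrite FD.
rewrite big_split /=; congr (_ + _).
  rewrite (@sum_widen_support _ _ s) ?undup_uniq //.
  - by apply: eq_big_seq => i ->.
  - by move=> i; rewrite mem_undup mem_cat => ->.
  - by move=> i /negPf ->.
rewrite (@sum_widen_support _ _ t) ?undup_uniq //.
- by apply: eq_big_seq => i ->.
- by move=> i; rewrite mem_undup mem_cat orbC => ->.
- by move=> i /negPf ->.
Qed.

(** This reduces [x = 0] to [x ** lvertex v = 0] for every vertex [v]. *)
Lemma local_unit x : exists u : L, x ** u = x /\
  exists2 s : seq (vertex E), uniq s & u = \sum_(v <- s) lvertex v.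
Proof.
(* Allowing every larger list [t] makes the claim stable under sums, where two lists are merged. *)
suff [s us xs] : exists2 s : seq (vertex E), uniq s &
    forall t, uniq t -> {subset s <= t} -> x ** (\sum_(v <- t) lvertex v) = x.
  by exists (\sum_(v <- s) lvertex v); split; [apply: xs|exists s].
have single y v : y ** lvertex v = y -> exists2 s, uniq s &
    forall t, uniq t -> {subset s <= t} -> y ** (\sum_(v <- t) lvertex v) = y.
  move=> yv; exists [:: v] => // t ut st.
  rewrite -[y in LHS]yv -numulA numul_sumr.
  rewrite (bigD1_seq v) ?st ?mem_head //= big1 ?addr0 ?lvertexM ?eqxx //.
  by move=> w wv; rewrite lvertexM eq_sym (negPf wv).
elim/leavitt_ind: x =>
  [v|e|e||x y [s us xs] [t ut yt]|k x [s us xs]|x y _ [s us xs]].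
- by apply: (single _ v); rewrite lvertexM eqxx.
- by apply: (single _ (erange e)); apply: ledge_range.
- by apply: (single _ (esource e)); apply: lghost_source.
- by exists [::] => // t _ _; rewrite numul0l.
- exists (undup (s ++ t)); first exact: undup_uniq.
  move=> r ur str; rewrite numulDl xs ?yt // => v vs; apply: str.
    by rewrite mem_undup mem_cat vs orbT.
  by rewrite mem_undup mem_cat vs.
- by exists s => // t ut st; rewrite -nuscaleAl xs.
- by exists s => // t ut st; rewrite -numulA xs.
Qed.

(** Indices carry the source besides the edges, so that empty walks at different vertices stay
    distinct. *)
Definition real_elt x : Prop :=
  exists (s : seq (vertex E * seq (edge E))) (a : _ -> K),
    [/\ uniq s, {in s, forall m, is_walk m.1 m.2} &
        x = \sum_(m <- s) a m *: walk m.1 m.2].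

Lemma real_elt0 : real_elt 0.
Proof. by exists [::], (fun=> 0); rewrite big_nil. Qed.

Lemma real_eltD x y : real_elt x -> real_elt y -> real_elt (x + y).
Proof.
move=> [s [a [us ws ->]]] [t [b [ut wt ->]]].
exists (undup (s ++ t)),
  (fun m => (if m \in s then a m else 0) + (if m \in t then b m else 0)).
split; first exact: undup_uniq.
  by move=> m; rewrite mem_undup mem_cat => /orP[/ws|/wt].
rewrite (sum_undup_cat (F := fun m k => k *: walk m.1 m.2)) // => m.
  exact: scale0r.
exact: scalerDl.
Qed.

Lemma real_eltZ k x : real_elt x -> real_elt (k *: x).
Proof.
move=> [s [a [us ws ->]]]; exists s, (fun m => k * a m); split=> //.
by rewrite scaler_sumr; apply: eq_bigr => m _; rewrite scalerA.
Qed.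

Lemma real_elt_sum (T : Type) (r : seq T) (P : pred T) (F : T -> L) :
  (forall i, P i -> real_elt (F i)) -> real_elt (\sum_(i <- r | P i) F i).
Proof. by move=> H; apply: big_ind H; [apply: real_elt0|apply: real_eltD]. Qed.

Lemma real_elt_walk u p : is_walk u p -> real_elt (walk u p).
Proof.
move=> wp; exists [:: (u, p)], (fun=> 1); split=> //.
  by move=> m; rewrite inE => /eqP ->.
by rewrite big_seq1 scale1r.
Qed.

Lemma real_elt_vertex v : real_elt (lvertex v).
Proof. exact: (@real_elt_walk v [::]). Qed.

Lemma real_eltM_vertex x v : real_elt x -> real_elt (x ** lvertex v).
Proof.
move=> [s [a [us ws ->]]]; rewrite numul_suml big_seq_cond.
apply: real_elt_sum => m; rewrite andbT => /ws wm.
rewrite -nuscaleAl; apply: real_eltZ; rewrite walkM_vertex.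
by case: ifP => _; [apply: real_elt_walk|apply: real_elt0].
Qed.

Lemma real_eltM_edge x e : real_elt x -> real_elt (x ** ledge e).
Proof.
move=> [s [a [us ws ->]]]; rewrite numul_suml big_seq_cond.
apply: real_elt_sum => m; rewrite andbT => /ws wm.
rewrite -nuscaleAl; apply: real_eltZ; rewrite walkM_edge.
case: eqP => [em|_]; last exact: real_elt0.
by apply: real_elt_walk; rewrite is_walk_rcons wm em eqxx.
Qed.

(* The elements of L_K(E) that are combinations of products mu nu^* with nu of
   length at most [n]. *)
Fixpoint ghost_le n x : Prop :=
  if n is m.+1 then
    exists (s : seq (edge E)) (a : edge E -> L) (y : L),
      [/\ uniq s, forall e, ghost_le m (a e), real_elt y &
          x = y + \sum_(e <- s) a e ** lghost e]
  else real_elt x.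

Lemma real_ghost_le n x : real_elt x -> ghost_le n x.
Proof.
elim: n x => //= n IHn x rx; exists [::], (fun=> 0), x; split=> //.
  by move=> _; apply/IHn; apply: real_elt0.
by rewrite big_nil addr0.
Qed.

Lemma ghost_le0 n : ghost_le n 0.
Proof. by apply: real_ghost_le; apply: real_elt0. Qed.

Lemma ghost_leD n x y : ghost_le n x -> ghost_le n y -> ghost_le n (x + y).
Proof.
elim: n x y => [|n IHn] x y; first exact: real_eltD.
move=> [s [a [x' [us ga rx ->]]]] [t [b [y' [ut gb ry ->]]]].
exists (undup (s ++ t)),
  (fun e => (if e \in s then a e else 0) + (if e \in t then b e else 0)), (x' + y').
split; first exact: undup_uniq.
- move=> e; apply: IHn; case: ifP => _.
  + exact: ga.
  + exact: ghost_le0.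
  + exact: gb.
  + exact: ghost_le0.
- exact: real_eltD.
rewrite addrACA; congr (_ + _); symmetry.
apply: (@sum_undup_cat _ L L (fun e z => z ** lghost e)) us ut => e.
  exact: numul0l.
by move=> c d; apply: numulDl.
Qed.

Lemma ghost_leZ n k x : ghost_le n x -> ghost_le n (k *: x).
Proof.
elim: n x => [|n IHn] x; first exact: real_eltZ.
move=> [s [a [y [us ga ry ->]]]].
exists s, (fun e => k *: a e), (k *: y); split=> //.
  by move=> e; apply: IHn (ga e).
  exact: real_eltZ.
by rewrite scalerDr scaler_sumr; under eq_bigr do rewrite nuscaleAl.
Qed.

Lemma ghost_le_leq m n x : (m <= n)%N -> ghost_le m x -> ghost_le n x.
Proof.
elim: m n x => [|m IHm] [|n] x //; first by move=> _; apply: real_ghost_le.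
rewrite ltnS => mn [s [a [y [us ga ry ->]]]]; exists s, a, y; split=> // e.
exact: IHm (ga e).
Qed.

Lemma ghost_leM_vertex n x v : ghost_le n x -> ghost_le n (x ** lvertex v).
Proof.
case: n => [|n]; first exact: real_eltM_vertex.
move=> [s [a [y [us ga ry ->]]]].
exists s, (fun e => if esource e == v then a e else 0), (y ** lvertex v).
split=> //.
- by move=> e; case: ifP => _; [apply: ga | apply: ghost_le0].
- exact: real_eltM_vertex.
rewrite numulDl numul_suml; congr (_ + _); apply: eq_bigr => e _.
rewrite -lghost_source -!numulA lvertexM.
by case: eqP => _; rewrite ?numul0l ?numul0r.
Qed.

(** Each [lghost f ** ledge e] collapses to a vertex or to 0, so a real edge on the right never
    lengthens ghost paths. *)
Lemma ghost_leM_edge n x e : ghost_le n x -> ghost_le n (x ** ledge e).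
Proof.
case: n => [|n]; first exact: real_eltM_edge.
move=> [s [a [y [us ga ry ->]]]]; rewrite numulDl numul_suml; apply: ghost_leD.
  exact/real_ghost_le/real_eltM_edge.
apply: (big_ind (ghost_le n.+1)); first exact: ghost_le0.
  exact: ghost_leD.
move=> f _; rewrite -numulA lghost_edge; case: eqP => _.
  by apply: ghost_le_leq (leqnSn n) _; apply: ghost_leM_vertex (ga f).
by rewrite numul0r; apply: ghost_le0.
Qed.

Lemma ghost_leM_ghost n x e : ghost_le n x -> ghost_le n.+1 (x ** lghost e).
Proof.
move=> gx; exists [:: e], (fun=> x), 0; split=> //; first exact: real_elt0.
by rewrite big_seq1 add0r.
Qed.

Lemma ghost_le_exists x : exists n, ghost_le n x.
Proof.
(* Quantifying over the left factor [z] reduces products to right multiplication by single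
   generators. *)
have mulP y : forall z n, ghost_le n z -> exists m, ghost_le m (z ** y).
  elim/leavitt_ind: y => [v|e|e||y1 y2 H1 H2|k y H|y1 y2 H1 H2] z n gz.
  - by exists n; apply: ghost_leM_vertex.
  - by exists n; apply: ghost_leM_edge.
  - by exists n.+1; apply: ghost_leM_ghost.
  - by exists 0%N; rewrite numul0r; apply: real_elt0.
  - have [m1 g1] := H1 _ _ gz; have [m2 g2] := H2 _ _ gz.
    exists (maxn m1 m2); rewrite numulDr.
    by apply: ghost_leD; [apply: ghost_le_leq g1|apply: ghost_le_leq g2];
      rewrite ?leq_maxl ?leq_maxr.
  - by have [m g] := H _ _ gz; exists m; rewrite -nuscaleAr; apply: ghost_leZ.
  - by have [m g] := H1 _ _ gz; rewrite numulA; apply: H2 g.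
have ghost e : lghost e = lvertex (erange e) ** lghost e :> L.
  by rewrite lrange_ghost.
have edge e : ledge e = lvertex (esource e) ** ledge e :> L.
  by rewrite lsource_edge.
have vertex v := real_ghost_le 0 (real_elt_vertex v).
elim/leavitt_ind: x => [v|e|e||y1 y2 [m1 g1] [m2 g2]|k y [m g]|y1 y2 [m g] _].
- by exists 0%N.
- by rewrite edge; apply: mulP (vertex _).
- by rewrite ghost; apply: mulP (vertex _).
- by exists 0%N; apply: real_elt0.
- exists (maxn m1 m2).
  by apply: ghost_leD; [apply: ghost_le_leq g1|apply: ghost_le_leq g2];
    rewrite ?leq_maxl ?leq_maxr.
- by exists m; apply: ghost_leZ.
- exact: mulP g.
Qed.

End GhostDegree.

(** * Ideals avoiding vertices and polynomials in exit-free cycles *)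

Section Reduction.
Variables (K : fieldType) (E : digraph) (I : leavitt K E -> Prop).
Hypothesis IMl : forall x y, I y -> I (x ** y).
Hypothesis IMr : forall x y, I x -> I (x ** y).
Hypothesis I_vertex : forall k v, k != 0 -> ~ I (k *: lvertex v).
Hypothesis I_cycle : forall v c (P : {poly K}), closed_walk v c ->
  graph_cycle c -> no_exit c -> P != 0 -> ~ I (cycle_horner v c P).

(** All the walks are powers of one shortest cycle [c], so the combination is P(c) for a polynomial
    with constant term [k]. *)
Lemma no_exit_closed_walks_notin k v (l : seq (K * seq (edge E))) :
    k != 0 -> (forall t, t \in l -> closed_walk v t.2 /\ no_exit t.2) ->
  ~ I (k *: lvertex v + \sum_(t <- l) t.1 *: walk v t.2).
Proof.
move=> k0; case: l => [|t0 l].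
  by move=> _; rewrite big_nil addr0; apply: I_vertex.
move E1: (t0 :: l) => l' Hl'.
have [ct0 nt0] : closed_walk v t0.2 /\ no_exit t0.2.
  by apply: Hl'; rewrite -E1 mem_head.
have [c [cc nc minc]] := shortest_no_exit ct0 nt0.
have /and3P[c0 wc /eqP ec] := cc.
pose P := k%:P + \sum_(t <- l') t.1 *: 'X^(size t.2 %/ size c).
have evP : cycle_horner v c P =
    k *: lvertex v + \sum_(t <- l') t.1 *: walk v t.2.
  rewrite cycle_hornerD cycle_hornerC; congr (_ + _).
  rewrite (big_morph _ (@cycle_hornerD K E v c) (@cycle_horner0 K E v c)).
  apply: eq_big_seq => t /Hl' [ct nt].
  by rewrite cycle_hornerZ cycle_hornerXn -(no_exit_closed_walkE cc nc minc).
rewrite -evP; apply: I_cycle => //; first exact: shortest_graph_cycle minc.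
(* Minimality of [c] makes every exponent in the sum positive, so the constant coefficient of [P] is
   [k]. *)
apply: contraNneq k0 => P0; have := coef0 K 0; rewrite -P0 coefD coefC /=.
rewrite coef_sum big_seq big1 ?addr0 => [->|t /Hl'[ct nt]] //.
rewrite coefZ coefXn eq_sym -leqn0 leqNgt divn_gt0 ?minc ?mulr0 //.
by rewrite lt0n size_eq0.
Qed.

Lemma closed_walks_notin k v (l : seq (K * seq (edge E))) :
    k != 0 -> (forall t, t \in l -> closed_walk v t.2) ->
  ~ I (k *: lvertex v + \sum_(t <- l) t.1 *: walk v t.2).
Proof.
move=> k0; have [n] := ubnP (size l); elim: n l v => // n IHn l v; rewrite ltnS.
move=> ln Hl Il.
have [[t tl [f [e et [sf fe]]]]|nex] :=
    pselect (exists2 t, t \in l & exists f, is_exit f t.2); last first.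
  apply: no_exit_closed_walks_notin Il => // t tl; split; first exact: Hl.
  by move=> f ft; apply: nex; exists t => //; exists f.
have /and3P[_ wt /eqP vt] := Hl _ tl.
have [rho [sg tE]] : exists rho sg, t.2 = rho ++ e :: sg.
  by case/splitPr: et => rho sg; exists rho, sg.
(* Conjugating by a walk [tau] leaving [t.2] through its exit [f] kills the
   term of [t] and leaves the shape of the combination unchanged. *)
pose tau := rcons rho f.
have wtau : is_walk v tau.
  move: wt; rewrite tE is_walk_cat is_walk_rcons => /andP[-> /andP[/eqP <- _]].
  by rewrite sf eqxx.
have etau : walk_end v tau = erange f by rewrite walk_end_rcons.
(* The surviving terms satisfy [t'.2 ++ tau = tau ++ q], where [q] is a closed walk at [erange f] as
   long as [t'.2]. *)
pose good (t' : K * seq (edge E)) := prefix tau (t'.2 ++ tau).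
pose l' := [seq (t'.1, drop (size tau) (t'.2 ++ tau)) | t' <- l & good t'].
have : I (cowalk v tau **
    (k *: lvertex v + \sum_(t <- l) t.1 *: walk v t.2) ** walk v tau).
  by apply/IMr/IMl.
rewrite numulDr numulDl -nuscaleAr -nuscaleAl -numulA source_walk.
rewrite cowalk_walk // etau numul_sumr numul_suml.
suff -> : \sum_(t' <- l) cowalk v tau ** (t'.1 *: walk v t'.2) ** walk v tau =
    \sum_(t' <- l') t'.1 *: walk (erange f) t'.2.
  apply: IHn.
    (* The list gets shorter because [t] is not good: after [rho] it continues with [e], whereas
       [tau] continues with [f]. *)
    apply: leq_trans ln; rewrite size_map size_filter ltn_neqAle count_size andbT.
    rewrite -all_count; apply/allPn; exists t => //.
    rewrite /good tE /tau -cats1 -!catA prefix_catr // /=.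
    by have /eqP/negPf -> := fe; rewrite andbF.
  move=> _ /mapP[t' + ->]; rewrite mem_filter => /andP[/prefixP[q qE] /Hl].
  case/and3P=> t'0 wt' /eqP vt' /=; rewrite qE drop_size_cat //; apply/and3P; split.
  - apply: contra_neq t'0 => q0; apply: size0nil.
    move: (congr1 size qE); rewrite q0 cats0 size_cat.
    by move/eqP; rewrite -[X in _ == X]add0n eqn_add2r => /eqP.
  - have: is_walk v (tau ++ q) by rewrite -qE is_walk_cat wt' vt'.
    by rewrite is_walk_cat etau => /andP[].
  - by rewrite -etau -walk_end_cat -qE walk_end_cat vt'.
rewrite big_map big_filter [RHS]big_mkcond /=; apply: eq_big_seq => t' t'l.
have /and3P[_ wt' /eqP vt'] := Hl _ t'l.
rewrite -nuscaleAr -nuscaleAl -numulA -[in walk v tau]vt' walkM.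
rewrite /good; case: ifPn => [/prefixP[q qE]|npt].
  by rewrite qE cowalkK // drop_size_cat // etau.
rewrite cowalk_walk0 ?scaler0 // ?is_walk_cat ?wt' ?vt' //.
by rewrite size_cat leq_addl.
Qed.

(** Cancelling a shortest walk with nonzero coefficient leads back to [closed_walks_notin]. The
    index type [T] also covers walks extended by a fixed edge, as in [real_eltM_edge_eq0]. *)
Lemma walks_free (T : eqType) (r : seq T) (a : T -> K) (s : T -> vertex E)
    (p : T -> seq (edge E)) :
    uniq r -> {in r, forall i, is_walk (s i) (p i)} ->
    {in r &, injective (fun i => (s i, p i))} ->
    I (\sum_(i <- r) a i *: walk (s i) (p i)) ->
  {in r, forall i, a i = 0}.
Proof.
move=> ur wr injr Ix i0 i0r; apply/eqP/contraT => ai0.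
pose Q n := has (fun j => (a j != 0) && (size (p j) == n)) r.
have exQ : exists n, Q n.
  by exists (size (p i0)); apply/hasP; exists i0 => //; rewrite ai0 eqxx.
case: (ex_minnP exQ) => n /hasP[j jr /andP[aj /eqP pj]] minj.
have min_size i : i \in r -> a i != 0 -> (size (p j) <= size (p i))%N.
  by move=> ir ai; rewrite pj; apply: minj; apply/hasP; exists i; rewrite ?ai ?eqxx.
set u := s j; set v := walk_end u (p j).
(* Right multiplication by [lvertex v] selects the walks ending at [v], so stripping [p j] leaves
   closed walks at [v]. *)
pose good i := [&& i != j, a i != 0, s i == u, prefix (p j) (p i) &
                   walk_end u (p i) == v].
pose l := [seq (a i, drop (size (p j)) (p i)) | i <- r & good i].
exfalso; apply: (@closed_walks_notin (a j) v l aj).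
  move=> _ /mapP[i + ->]; rewrite mem_filter => /andP[+ ir].
  case/and5P=> ij _ /eqP si /prefixP[q qE] /eqP vi /=.
  have := wr _ ir; rewrite si qE drop_size_cat // is_walk_cat => /andP[_ wq].
  have vq : walk_end v q = v by move: vi; rewrite qE walk_end_cat.
  rewrite /closed_walk wq vq eqxx !andbT.
  (* An empty remainder would make [i] and [j] index the same walk. *)
  apply: contra_neq ij => q0; apply: injr => //.
  by rewrite si qE q0 cats0.
suff <- : cowalk u (p j) ** (\sum_(i <- r) a i *: walk (s i) (p i)) ** lvertex v
    = a j *: lvertex v + \sum_(t <- l) t.1 *: walk v t.2.
  exact/IMr/IMl.
rewrite numul_sumr numul_suml big_map big_filter (bigD1_seq j) //=; congr (_ + _).
  rewrite -nuscaleAr -nuscaleAl cowalk_walk ?wr //.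
  by rewrite lvertexM eqxx.
rewrite [LHS]big_mkcond [RHS]big_mkcond /=.
apply: eq_big_seq => i ir; rewrite /good.
have [//|ij /=] := eqVneq i j; rewrite -nuscaleAr -nuscaleAl -numulA walkM_vertex.
have [->|ai /=] := eqVneq (a i) 0; first by rewrite scale0r.
have [si|su] /= := eqVneq (s i) u; last first.
  case: ifP => _; last by rewrite numul0r scaler0.
  rewrite -[cowalk u _]cowalk_source -numulA -[walk (s i) _]source_walk.
  by rewrite [lvertex u ** _]numulA lvertexM eq_sym
             (negPf su) numul0l numul0r scaler0.
rewrite si; case: ifP => vi; last by rewrite numul0r scaler0 andbF.
rewrite andbT; case: ifPn => [/prefixP[q qE]|npi].
  by rewrite qE cowalkK ?wr // drop_size_cat.
by rewrite cowalk_walk0 ?scaler0 ?min_size ?wr // -si wr.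
Qed.

Lemma real_elt_eq0 x : real_elt x -> I x -> x = 0.
Proof.
move=> [s [a [us ws ->]]] Ix; rewrite big_seq big1 // => m ms.
suff -> : a m = 0 by rewrite scale0r.
by apply: (walks_free us ws _ Ix ms) => -[? ?] [? ?] _ _ [-> ->].
Qed.

(** Appending [f] keeps distinct walks distinct, so [walks_free] kills the coefficient of every walk
    ending at [esource f]. *)
Lemma real_eltM_edge_eq0 x f :
  real_elt x -> I (x ** ledge f) -> x ** lvertex (esource f) = 0.
Proof.
move=> [s [a [us ws ->]]] Ix.
pose t := [seq m <- s | walk_end m.1 m.2 == esource f].
have {}Ix : I (\sum_(m <- t) a m *: walk m.1 (rcons m.2 f)).
  suff <- : (\sum_(m <- s) a m *: walk m.1 m.2) ** ledge f =
      \sum_(m <- t) a m *: walk m.1 (rcons m.2 f) by [].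
  rewrite numul_suml big_filter [RHS]big_mkcond; apply: eq_bigr => m _.
  by rewrite -nuscaleAl walkM_edge; case: ifP => _; rewrite ?scaler0.
have a0 : {in t, forall m, a m = 0}.
  apply: (walks_free _ _ _ Ix); first exact: filter_uniq.
    move=> m; rewrite mem_filter => /andP[/eqP em ms].
    by rewrite is_walk_rcons ws // em eqxx.
  by move=> [? ?] [? ?] _ _ [-> /rcons_inj[->]].
rewrite numul_suml big_seq big1 // => m ms.
rewrite -nuscaleAl walkM_vertex; case: ifP => em; last by rewrite scaler0.
by rewrite a0 ?scale0r // mem_filter em.
Qed.

Lemma vertex_cycle_free_ideal_eq0 x : I x -> x = 0.
Proof.
have [n] := ghost_le_exists x; elim: n x => [|n IHn] x; first exact: real_elt_eq0.
move=> [s [a [y [us ga ry xE]]]] Ix.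
have xe0 e : e \in s -> x ** ledge e = y ** ledge e + a e ** lvertex (erange e).
  move=> es; rewrite xE numulDl numul_suml (bigD1_seq e) //= -numulA lghost_edge.
  rewrite eqxx big1 ?addr0 // => f fe.
  by rewrite -numulA lghost_edge (negPf fe) numul0r.
have xe e : e \in s -> x ** ledge e = 0.
  move=> es; apply: IHn; last exact: IMr.
  rewrite xe0 //; apply: ghost_leD; first exact/real_ghost_le/real_eltM_edge.
  exact: ghost_leM_vertex (ga e).
suff xv v : x ** lvertex v = 0.
  have [u [<- [t _ ->]]] := local_unit x.
  by rewrite numul_sumr big1.
have [[f fv fs]|allv] := pselect (exists2 f, esource f = v & f \notin s).
  have yv : y ** lvertex v = 0.
    rewrite -fv; apply: real_eltM_edge_eq0 => //.
    suff <- : x ** ledge f = y ** ledge f by apply: IMr.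
    rewrite xE numulDl numul_suml big_seq big1 ?addr0 // => e es.
    rewrite -numulA lghost_edge; case: eqP => [ef|_]; last by rewrite numul0r.
    by rewrite -ef es in fs.
  rewrite xE numulDl yv add0r numul_suml big_seq big1 // => e es.
  rewrite -numulA -lghost_source -numulA lvertexM.
  case: eqP => [ev|_]; last by rewrite !numul0r.
  (* As [x ** ledge e = 0], the element [a e ** lvertex (erange e)] is the opposite of
     [y ** ledge e], which factors through [y ** lvertex v = 0]. *)
  rewrite lghost_source -lrange_ghost numulA.
  have /eqP := xe0 e es; rewrite (xe e es) eq_sym addrC addr_eq0 => /eqP ->.
  by rewrite -lsource_edge ev numulA yv numul0l oppr0 numul0l.
(* Now all edges leaving [v] lie in [s], so [v] is either a sink or regular. *)
pose s' := [seq e <- s | esource e == v].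
have emE : emitted v = [set` s']%classic.
  apply/seteqP; split=> e /=; rewrite mem_filter; last by case/andP=> /eqP.
  move=> ev; rewrite ev eqxx /=; apply: contrapT => /negP es.
  by apply: allv; exists e.
have [s'0|[e es']] : s' = [::] \/ exists e, e \in s'.
  by case: (s') => [|e t]; [left|right; exists e; apply: mem_head].
  (* At a sink no ghost edge survives, which leaves a real element of the ideal. *)
  suff xvE : x ** lvertex v = y ** lvertex v.
    apply: real_elt_eq0; last exact: IMr.
    by rewrite xvE; apply: real_eltM_vertex.
  rewrite xE numulDl numul_suml big_seq big1 ?addr0 // => e es.
  rewrite -lghost_source -!numulA lvertexM.
  case: eqP => [ev|_]; last by rewrite !numul0r.
  have : e \in s' by rewrite mem_filter ev eqxx.
  by rewrite s'0.
have rv : regular v.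
  by split; [rewrite emE; apply: finite_seq|exists e; rewrite emE].
rewrite lvertex_regular // emE -fsbig_seq ?filter_uniq // numul_sumr.
rewrite big_seq big1 // => f; rewrite mem_filter => /andP[_ /xe].
by rewrite numulA => ->; rewrite numul0l.
Qed.

End Reduction.

(** * Polynomials in a cycle under a homomorphism to a graded algebra *)

Lemma cycle_horner_notin_ker (E : digraph) (K : fieldType) (A : nualgType K)
    (gr : int -> set A) (pi : {additive leavitt K E -> A}) (n : int)
    (v : vertex E) (c : seq (edge E)) (P : {poly K}) :
    Zgrading gr -> (forall x y : leavitt K E, pi (x ** y) = pi x ** pi y) ->
    walk_end v c = v -> n <> 0 -> gr n (pi (walk v c)) ->
    ~ nilpotent_elt (pi (walk v c)) -> P != 0 ->
  pi (cycle_horner v c P) <> 0.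
Proof.
move=> grA piM vc n0 gra nila; set a := pi (walk v c).
have [m] := ubnP (size P); elim: m P => // m IHm P; rewrite ltnS => Pm P0 piP.
have /factor_theorem[Q PQ] : root (P - P.[1]%:P) 1.
  by rewrite /root hornerD hornerN hornerC subrr.
set k := P.[1] in PQ.
have PE : P = 'X * Q - Q + k%:P.
  by apply/eqP; rewrite -subr_eq PQ mulrBr mulrC mulr1.
have evP : cycle_horner v c P =
    walk v c ** cycle_horner v c Q - cycle_horner v c Q + k *: lvertex v.
  rewrite [in LHS]PE !cycle_hornerD cycle_hornerC // -scaleN1r cycle_hornerZ.
  by rewrite scaleN1r cycle_hornerMX.
have {piP} := piP; rewrite evP raddfD raddfB piM => piP.
have [k0|k0] := eqVneq k 0.
  move: piP; rewrite k0 scale0r raddf0 addr0 => /eqP; rewrite subr_eq0 => /eqP piQ.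
  have Q0 : Q != 0.
    by apply: contra_neq P0 => Q0; rewrite PE Q0 k0 mulr0 subrr add0r.
  apply: (IHm Q _ Q0 (homogeneous_fix_eq0 grA n0 gra piQ)).
  apply: leq_trans Pm; move: PQ; rewrite k0 polyC0 subr0 => ->.
  by rewrite size_Mmonic ?monicXsubC // size_XsubC addn2.
(* The right factor turns [pi (k *: lvertex v)] into [a], since the two scalars cancel inside [pi];
   the relation becomes [d - a ** d = a]. *)
pose d := pi (cycle_horner v c Q) ** (pi (k^-1 *: lvertex v) ** a).
apply: (@homogeneous_sub_neq _ _ _ grA n a d n0 gra nila).
have : (a ** pi (cycle_horner v c Q) - pi (cycle_horner v c Q) +
         pi (k *: lvertex v)) ** (pi (k^-1 *: lvertex v) ** a) = 0.
  by rewrite piP numul0l.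
rewrite numulDl numulBl -numulA -/d [pi _ ** (_ ** a)]numulA -piM.
rewrite -nuscaleAl -nuscaleAr scalerA mulfV // scale1r lvertexM eqxx -piM.
by rewrite source_walk -opprB => /eqP; rewrite addrC subr_eq0 => /eqP.
Qed.

Theorem theorem3p7 (E : digraph) (K : fieldType) (A : nualgType K)
    (gr : int -> set A) (grA : Zgrading gr)
    (pi : {additive leavitt K E -> A})
    (piM : forall x y : leavitt K E, pi (x ** y) = pi x ** pi y)
    (pi_vertex : forall v : vertex E, pi (lvertex v) <> 0)
    (pi_cycle : forall c : seq (edge E), graph_cycle c -> no_exit c ->
       ~ nilpotent_elt (pi (lpath c)) /\
       exists2 n : int, n <> 0 & gr n (pi (lpath c))) :
  injective pi.
Proof.
apply: raddf_inj; apply: vertex_cycle_free_ideal_eq0.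
- by move=> x y pi0; rewrite piM pi0 numul0r.
- by move=> x y pi0; rewrite piM pi0 numul0l.
- move=> k v k0 pi0; apply: (pi_vertex v).
  (* The scalar is removed inside the algebra, as [pi] is additive and multiplicative but not
     assumed [K]-linear. *)
  have -> : lvertex v = (k^-1 *: lvertex v) ** (k *: lvertex v) :> leavitt K E.
    by rewrite -nuscaleAl -nuscaleAr scalerA mulVf // scale1r lvertexM eqxx.
  by rewrite piM pi0 numul0r.
- move=> v c P /and3P[c0 wc /eqP ec] gc nc.
  have [nila [n n0 grn]] := pi_cycle c gc nc.
  have cE : lpath c = walk v c :> leavitt K E.
    by case: (c) c0 wc => // e p _ /= /andP[/eqP sv _]; apply: lpathE.
  by rewrite cE in nila grn; apply: cycle_horner_notin_ker grA piM ec n0 grn nila.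
Qed.
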